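(* Let $A$ be a closed subset of $\mathbb{R}^d$. Then $$\operatorname{reach}(A)\le \operatorname{rconv}(A).$$ Moreover, if the topological boundary $\partial A$ is a $C^1$-smooth $(d-1)$-dimensional manifold without boundary, then $$\operatorname{reach}(A)=\operatorname{rconv}(A).$$
   Context: $\mathbb{R}^d$ carries the Euclidean norm $\|\cdot\|_2$, $\mathbb{R}^+=(0,\infty)$, $A^c$ is the complement of $A$ in $\mathbb{R}^d$, and $B(s,r)=\{t\in\mathbb{R}^d:\|t-s\|_2\le r\}$ is the closed ball. Minkowski sum: $A\oplus B=\{x+y:x\in A,\,y\in B\}$; Minkowski difference: $A\ominus B=\bigcap_{y\in B}(A\oplus\{y\})=(A^c\oplus B)^c$. For $r\in\mathbb{R}$, $A_r:=A\oplus B(0,r)$ if $r\ge 0$, and $A_r:=A\ominus B(0,-r)$ if $r<0$. Define $A_{\bullet r}:=(A_r)_{-r}$ for $r\in\mathbb{R}$ (closing of $A$ by $B(0,r)$ if $r\ge0$; opening by $B(0,-r)$ if $r<0$). The reach of $A\subseteq\mathbb{R}^d$ is $\operatorname{reach}(A):=\sup\{r\in\mathbb{R}^+:\forall y\in A_r\ \exists!\,x\in A\text{ nearest to }y\}\in[0,\infty]$, with the supremum of the empty set taken to be $0$. For closed $A$, $\operatorname{rconv}(A):=\sup\{r\in\mathbb{R}: A_{\bullet r}=A\}\in[0,\infty]$. *)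

(* Defs.v *)
From mathcomp Require Import all_boot all_order all_algebra.
From mathcomp Require Import all_classical all_reals all_analysis.
Import Order.TTheory GRing.Theory Num.Theory.
Import numFieldNormedType.Exports.

Set Implicit Arguments.
Unset Strict Implicit.
Unset Printing Implicit Defensive.

Local Open Scope classical_set_scope.
Local Open Scope ring_scope.

(* The library norm `|x| on 'rV[R]_d is the max norm, so the Euclidean norm is
   defined separately; both norms induce the library topology of 'rV[R]_d, which
   is the one used by [open], [closed], [closure] and [differentiable]. *)
Definition enorm (R : realType) (d : nat) (x : 'rV[R]_d) : R :=
  Num.sqrt (\sum_(i < d) x ord0 i ^+ 2).

Definition eball (R : realType) (d : nat) (s : 'rV[R]_d) (r : R) :
    set 'rV[R]_d :=
  [set t | enorm (t - s) <= r].

Definition msum (R : realType) (d : nat) (A B : set 'rV[R]_d) :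
    set 'rV[R]_d :=
  [set x + y | x in A & y in B].

Definition mdiff (R : realType) (d : nat) (A B : set 'rV[R]_d) :
    set 'rV[R]_d :=
  \bigcap_(y in B) msum A [set y].

(* A_r *)
Definition offset (R : realType) (d : nat) (A : set 'rV[R]_d) (r : R) :
    set 'rV[R]_d :=
  if 0 <= r then msum A (eball 0 r) else mdiff A (eball 0 (- r)).

(* A_{\bullet r}: closing of A for 0 <= r, opening for r < 0 *)
Definition bullet (R : realType) (d : nat) (A : set 'rV[R]_d) (r : R) :
    set 'rV[R]_d :=
  offset (offset A r) (- r).

Definition is_nearest (R : realType) (d : nat) (A : set 'rV[R]_d)
    (y x : 'rV[R]_d) : Prop :=
  A x /\ forall a, A a -> enorm (y - x) <= enorm (y - a).

(* The elements of the set are positive, so the maximum with 0 only matters when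
   the set is empty: it turns ereal_sup set0 = -oo into the convention
   sup set0 = 0. *)
Definition reach (R : realType) (d : nat) (A : set 'rV[R]_d) : \bar R :=
  maxe 0%E (ereal_sup [set r%:E | r in
    [set r : R | 0 < r /\ forall y, offset A r y -> exists! x, is_nearest A y x]]).

(* No convention on sup set0 is involved here: r = 0 is always in the set. *)
Definition rconv (R : realType) (d : nat) (A : set 'rV[R]_d) : \bar R :=
  ereal_sup [set r%:E | r in [set r : R | bullet A r = A]].

Definition boundary (T : topologicalType) (A : set T) : set T :=
  closure A `\` interior A.

Definition C1_on (R : realType) (m n : nat) (U : set 'rV[R]_m)
    (f : 'rV[R]_m -> 'rV[R]_n) : Prop :=
  forall x, U x -> differentiable f x /\ {for x, continuous (jacobian f)}.

(* phi and psi are total functions, but only their restrictions to the open sets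
   U and V are meaningful. *)
Definition C1_diffeo (R : realType) (d : nat) (U V : set 'rV[R]_d)
    (phi psi : 'rV[R]_d -> 'rV[R]_d) : Prop :=
  [/\ open U, open V, C1_on U phi & C1_on V psi] /\
  [/\ forall x, U x -> V (phi x), forall y, V y -> U (psi y),
      forall x, U x -> psi (phi x) = x & forall y, V y -> phi (psi y) = y].

(* Embedded k-dimensional C^1 submanifold of R^d (k <= d), without boundary:
   around each point of M, a C^1 diffeomorphism between open sets of R^d
   straightens M to R^k x {0}. *)
Definition C1_submanifold (R : realType) (d k : nat) (M : set 'rV[R]_d) :
    Prop :=
  forall x, M x ->
    exists (U V : set 'rV[R]_d) (phi psi : 'rV[R]_d -> 'rV[R]_d),
      [/\ U x, C1_diffeo U V phi psi &
        phi @` (M `&` U) =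
          V `&` [set y | forall j : 'I_d, (k <= j)%N -> y ord0 j = 0]].

(* Main.v *)
Require Import Defs.
From mathcomp Require Import all_boot all_order all_algebra.
From mathcomp Require Import all_classical all_reals all_analysis.
From mathcomp Require Import ring lra.
Import Order.TTheory GRing.Theory Num.Theory.
Import numFieldNormedType.Exports.

Set Implicit Arguments.
Unset Strict Implicit.
Unset Printing Implicit Defensive.

Local Open Scope classical_set_scope.
Local Open Scope ring_scope.

(** Write d(y) for the distance from y to A.

    If nearest points are unique on A_r, then the closing of A by balls of radius
    r is A ([unique_nearest_bullet]). Suppose that x lies in the closing but not
    in A, so that d <= r on the closed ball B(x, r) although d(x) > 0. For a slope
    q slightly below 1, maximise d(y) - q |y - x| over B(x, r). At a point y with
    unique nearest point p, the distance grows with slope 1 in the direction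
    y - p ([distance_slope]), faster than q |y - x| can: a maximiser is thus on
    the boundary sphere, where d(y) >= d(x) + q r > r, a contradiction. This
    replaces the flow along the gradient of d by one extremal point.

    Conversely, let the closing of A by radius r be A, let the boundary of A be a
    C^1 hypersurface, and let y with 0 < d(y) < r have two nearest points x1, x2
    ([bullet_unique_nearest]). The points between x1 and y are outside A, hence in
    balls of radius r that miss A; moving them to x1, these balls accumulate at a
    ball B(z, r) whose interior misses A and which touches A at x1
    ([bullet_touching_ball]). Near x1 the hypersurface is the zero set of a
    function h with nonzero gradient. The ball around y and the approximating
    balls meet and are convex, so h has the same sign on all of them; both y - x1
    and z - x1 are therefore positive multiples of the gradient, up to a common
    sign ([touching_balls_aligned]). So B(z, r) and the smaller ball of radius
    d(y) around y are internally tangent at x1, and the interior of B(z, r) contains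
    all other points of the smaller ball. It contains x2, a contradiction. *)

(** * The Euclidean norm *)

Section Euclidean.
Context {R : realType} {d : nat}.
Implicit Types (x y z u v : 'rV[R]_d) (a b r t : R).

Definition dot u v : R := \sum_(i < d) u ord0 i * v ord0 i.

Lemma dotC u v : dot u v = dot v u.
Proof. by apply: eq_bigr => i _; rewrite mulrC. Qed.

Lemma dotDl u v x : dot (u + v) x = dot u x + dot v x.
Proof. by rewrite -big_split; apply: eq_bigr => i _; rewrite mxE mulrDl. Qed.

Lemma dotZl a u v : dot (a *: u) v = a * dot u v.
Proof. by rewrite mulr_sumr; apply: eq_bigr => i _; rewrite mxE mulrA. Qed.

Lemma dotNl u v : dot (- u) v = - dot u v.
Proof. by rewrite -scaleN1r dotZl mulN1r. Qed.

Lemma dotDr x u v : dot x (u + v) = dot x u + dot x v.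
Proof. by rewrite !(dotC x) dotDl. Qed.

Lemma dotZr a u v : dot u (a *: v) = a * dot u v.
Proof. by rewrite !(dotC u) dotZl. Qed.

Lemma dotNr u v : dot u (- v) = - dot u v.
Proof. by rewrite !(dotC u) dotNl. Qed.

Definition dotE := (dotDl, dotDr, dotNl, dotNr, dotZl, dotZr).

Lemma dotxx_ge0 u : 0 <= dot u u.
Proof. by apply: sumr_ge0 => i _; rewrite -expr2 sqr_ge0. Qed.

Lemma dotxx_eq0 u : (dot u u == 0) = (u == 0).
Proof.
rewrite psumr_eq0 => [|i _]; last by rewrite -expr2 sqr_ge0.
apply/idP/eqP => [/allP u0|->]; last by apply/allP => i _; rewrite mxE mul0r eqxx.
apply/rowP => i; rewrite mxE; apply/eqP.
by have := u0 i (mem_index_enum i); rewrite -expr2 sqrf_eq0.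
Qed.

Lemma enormE u : enorm u = Num.sqrt (dot u u).
Proof. by congr Num.sqrt; apply: eq_bigr => i _; rewrite expr2. Qed.

Lemma enorm_ge0 u : 0 <= enorm u.
Proof. exact: sqrtr_ge0. Qed.

Lemma sqr_enorm u : enorm u ^+ 2 = dot u u.
Proof. by rewrite enormE sqr_sqrtr ?dotxx_ge0. Qed.

Lemma enorm_eq0 u : (enorm u == 0) = (u == 0).
Proof. by rewrite -sqrf_eq0 sqr_enorm dotxx_eq0. Qed.

Lemma enorm0 : enorm (0 : 'rV[R]_d) = 0.
Proof. by apply/eqP; rewrite enorm_eq0. Qed.

Lemma enorm_gt0 u : (0 < enorm u) = (u != 0).
Proof. by rewrite lt_neqAle enorm_ge0 andbT eq_sym enorm_eq0. Qed.

Lemma enormN u : enorm (- u) = enorm u.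
Proof. by rewrite !enormE dotNl dotNr opprK. Qed.

Lemma enormB u v : enorm (u - v) = enorm (v - u).
Proof. by rewrite -enormN opprB. Qed.

Lemma enormZ a u : enorm (a *: u) = `|a| * enorm u.
Proof.
by rewrite !enormE dotZl dotZr mulrA -expr2 sqrtrM ?sqr_ge0// sqrtr_sqr.
Qed.

Lemma enorm_le_sqr a u : 0 <= a -> (enorm u <= a) = (dot u u <= a ^+ 2).
Proof. by move=> a0; rewrite -sqr_enorm ler_sqr ?nnegrE ?enorm_ge0. Qed.

Lemma enorm_lt_sqr a u : 0 <= a -> (enorm u < a) = (dot u u < a ^+ 2).
Proof. by move=> a0; rewrite -sqr_enorm ltr_sqr ?nnegrE ?enorm_ge0. Qed.

(** Cauchy-Schwarz, from the nonnegativity of the squared norm of |v| u - |u| v. *)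
Lemma dot_le_enorm u v : dot u v <= enorm u * enorm v.
Proof.
have [->|u0] := eqVneq u 0.
  by rewrite -(scale0r 0) dotZl mul0r mulr_ge0 ?enorm_ge0.
have [->|v0] := eqVneq v 0.
  by rewrite -(scale0r 0) dotZr mul0r mulr_ge0 ?enorm_ge0.
have uv0 : 0 < enorm u * enorm v by rewrite mulr_gt0 ?enorm_gt0.
have := dotxx_ge0 (enorm v *: u - enorm u *: v).
rewrite !dotE -!sqr_enorm (dotC v u) => H.
rewrite -(ler_pM2l uv0); lra.
Qed.

Lemma enormD u v : enorm (u + v) <= enorm u + enorm v.
Proof.
rewrite enorm_le_sqr ?addr_ge0 ?enorm_ge0// sqrrD !sqr_enorm !dotE (dotC v u).
have := dot_le_enorm u v; lra.
Qed.

Lemma enorm_triangle y x z : enorm (x - z) <= enorm (x - y) + enorm (y - z).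
Proof. by rewrite -[x - z](subrKA y) enormD. Qed.

Lemma eball_convex z r t x y : 0 <= t <= 1 ->
  eball z r x -> eball z r y -> eball z r (x + t *: (y - x)).
Proof.
rewrite /eball /= => /andP[t0 t1] xr yr.
have -> : x + t *: (y - x) - z = (1 - t) *: (x - z) + t *: (y - z).
  by apply/rowP => i; rewrite !mxE; ring.
apply: (le_trans (enormD _ _)); rewrite !enormZ !ger0_norm ?subr_ge0//.
have : (1 - t) * enorm (x - z) <= (1 - t) * r by rewrite ler_wpM2l// subr_ge0.
have : t * enorm (y - z) <= t * r by rewrite ler_wpM2l.
lra.
Qed.

Lemma enorm_continuous : continuous (@enorm R d).
Proof.
move=> x; apply: (@continuous_comp _ _ _ _ (@Num.sqrt R));
  last exact: sqrt_continuous.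
have -> : (fun u : 'rV[R]_d => \sum_(i < d) u ord0 i ^+ 2) =
    \sum_(i < d) (fun u : 'rV[R]_d => u ord0 i ^+ 2).
  by apply/funext => u; rewrite fct_sumE.
elim/big_ind : _ => [|f g cf cg|i _]; first exact: cst_continuous.
  exact: continuousD.
by apply: continuousM; exact: coord_continuous.
Qed.

Lemma edist_continuous x : continuous (fun y => enorm (y - x)).
Proof.
move=> y; apply: (@continuous_comp _ _ _ (fun y => y - x)).
  by apply: continuousB; [exact: cvg_id|exact: cst_continuous].
exact: enorm_continuous.
Qed.

Lemma le_coord_enorm u i : `|u ord0 i| <= enorm u.
Proof.
rewrite -(@ler_sqr R) ?nnegrE ?enorm_ge0// sqr_enorm /dot (bigD1 i)//=.
rewrite real_normK ?num_real// expr2 lerDl sumr_ge0// => j _.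
by rewrite -expr2 sqr_ge0.
Qed.

Lemma le_norm_enorm u : `|u| <= enorm u.
Proof.
rewrite [leLHS]/Num.norm /= mx_normrE; apply/bigmax_leP; split=> [|[i j] _ /=].
  exact: enorm_ge0.
by rewrite ord1 le_coord_enorm.
Qed.

Lemma nbhs_eball x r : 0 < r -> nbhs x (eball x r).
Proof.
move=> r0; have /cvgr_le := @edist_continuous x x; apply.
by rewrite subrr enorm0.
Qed.

(** The Euclidean and the maximum norm induce the same topology. *)
Lemma nbhs_eballP x (P : set 'rV[R]_d) :
  nbhs x P <-> exists2 r, 0 < r & eball x r `<=` P.
Proof.
split=> [/nbhs_normP[r /= r0 rP]|[r r0 rP]]; last first.
  exact: filterS rP (nbhs_eball x r0).
exists (r / 2) => [|y]; first by rewrite divr_gt0.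
rewrite /eball /= => yr; apply: rP; rewrite /= distrC.
by apply: (le_lt_trans (le_norm_enorm _)); lra.
Qed.

Lemma eball_closed x r : closed (eball x r).
Proof.
apply: (@closed_comp _ _ (fun y => enorm (y - x)) [set t | t <= r]);
  last exact: closed_le.
by move=> y _; exact: edist_continuous.
Qed.

Lemma eball_compact x r : compact (eball x r).
Proof.
apply: bounded_closed_compact; last exact: eball_closed.
exists (enorm x + r); split => [|M xrM y]; first exact: num_real.
rewrite /eball /= => yr; apply: (le_trans (le_norm_enorm _)).
by have := enormD (y - x) x; rewrite subrK; lra.
Qed.

(** The form of compactness used below: a bounded family indexed by small
    positive parameters accumulates somewhere as the parameter tends to 0. *)
Lemma bounded_family_cluster (P : R -> 'rV[R]_d -> Prop) t0 x r : 0 < t0 ->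
  (forall t, 0 < t < t0 -> exists2 z, P t z & eball x r z) ->
  exists z, forall e, 0 < e -> exists t z', [/\ 0 < t <= e, eball z e z' & P t z'].
Proof.
move=> t00 H.
have /choice[f Hf] : forall t, exists z, 0 < t < t0 -> P t z /\ eball x r z.
  move=> t; have [/H[z Pz zr]|nt] := pselect (0 < t < t0); first by exists z.
  by exists x.
have small e : 0 < e -> \forall t \near 0^'+, 0 < t < t0 /\ t <= e.
  move=> e0; near=> t; split; last by near: t; exact: nbhs_right_le.
  by apply/andP; split; near: t; [exact: nbhs_right_gt|exact: nbhs_right_lt].
have fB : (f @ 0^'+) (eball x r).
  by apply: filterS (small 1 ltr01) => t [tt0 _]; have [] := Hf t tt0.
have [z [_ clz]] := eball_compact (fmap_proper_filter f _) fB.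
exists z => e e0.
have fS : (f @ 0^'+) (f @` [set t | 0 < t < t0 /\ t <= e]).
  by apply: filterS (small e e0) => t te; exact: imageP.
have [_ [[t [tt0 te] <-] fz]] := clz _ _ fS (nbhs_eball z e0).
exists t, (f t); split => //; first by case/andP: tt0 => ->.
by have [] := Hf t tt0.
Unshelve. all: by end_near. Qed.

End Euclidean.

(** * Closings of sets with unique nearest points *)

Section Offsets.
Context {R : realType} {d : nat}.
Implicit Types (A : set 'rV[R]_d) (x y z : 'rV[R]_d) (r : R).

Lemma offsetP A r y : 0 <= r ->
  offset A r y <-> exists2 a, A a & enorm (y - a) <= r.
Proof.
rewrite /offset => ->; split => [[a Aa [b + <-]]|[a Aa ya]].
  by rewrite /eball /= subr0 => br; exists a => //; rewrite addrC addKr.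
by exists a => //; exists (y - a); rewrite /eball /= ?subr0 // addrC subrK.
Qed.

(** The case 0 < r is the closing: a point belongs to it when every ball of radius
    r that contains it meets A. *)
Lemma bulletP A r x : 0 < r -> bullet A r x <-> eball x r `<=` offset A r.
Proof.
move=> r0; rewrite /bullet [offset (offset A r) _]/offset lerNr oppr0 leNgt r0 /=.
rewrite /mdiff opprK; split => [H y|H y].
  rewrite /eball /= => yx.
  have [|a Aa [b -> xab]] := H (x - y); first by rewrite /eball /= subr0 enormB.
  suff -> : y = a by [].
  by apply: (addIr (x - y)); rewrite xab addrC subrK.
rewrite /eball /= subr0 => yr; exists (x - y).
  2: by exists y => //; rewrite subrK.
by apply: H; rewrite /eball /= addrC addKr enormN.
Qed.

Lemma sub_bullet A r : 0 < r -> A `<=` bullet A r.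
Proof.
move=> r0 x Ax; apply/bulletP => // y yx; apply/offsetP; first exact: ltW.
by exists x.
Qed.

Lemma bullet_notin A r x : 0 < r -> bullet A r = A -> ~ A x ->
  exists2 z, eball x r z & forall a, A a -> r < enorm (z - a).
Proof.
move=> r0 Ar nAx; apply: contrapT => H; apply: nAx; rewrite -Ar.
apply/bulletP => // z xz; apply/offsetP; first exact: ltW.
apply: contrapT => H'; apply: H; exists z => // a Aa; rewrite ltNge.
by apply/negP => za; apply: H'; exists a.
Qed.

Lemma nearest_exists A y : closed A -> A !=set0 -> exists x, is_nearest A y x.
Proof.
move=> cA [a Aa].
have cK : compact (A `&` eball y (enorm (y - a))).
  by rewrite setIC; apply: compact_closedI => //; exact: eball_compact.
have K0 : A `&` eball y (enorm (y - a)) !=set0.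
  by exists a; split => //; rewrite /eball /= enormB.
have cd : {within A `&` eball y (enorm (y - a)),
    continuous (fun x => enorm (x - y))}.
  exact/continuous_subspaceT/edist_continuous.
have [x] := compact_EVT_min K0 cK cd.
rewrite inE => -[Ax _] H; exists x; split => // b Ab; rewrite !(enormB y).
have [ba|/ltW ab] := leP (enorm (b - y)) (enorm (y - a)).
  by apply: H; rewrite inE.
apply: le_trans ab; rewrite (enormB y); apply: H; rewrite inE; split => //.
by rewrite /eball /= enormB.
Qed.

(** At a point y with unique nearest point p, the distance to A has slope 1 in the
    direction y - p, in the weak form that some step beats any slope q < 1.
    Nearest points of y + t (y - p) accumulate, as t tends to 0, at a nearest point
    of y, hence at p; and for a in A near p, |y + t (y - p) - a|^2 is at least about
    |y - p|^2 + 2 t |y - p|^2. *)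
Lemma distance_slope A y p q t0 : closed A -> is_nearest A y p ->
  (forall x, is_nearest A y x -> x = p) -> 0 < enorm (y - p) -> 0 <= q < 1 ->
  0 < t0 -> exists2 t, 0 < t <= t0 & forall a, A a ->
    enorm (y - p) + q * (t * enorm (y - p)) < enorm (y + t *: (y - p) - a).
Proof.
move=> cA [Ap yp] pU; set D := enorm (y - p) => D0 /andP[q0 q1] t00.
apply: contrapT => H.
pose P t a := A a /\ enorm (y + t *: (y - p) - a) <= D + q * (t * D).
have PB t : 0 < t < t0 -> exists2 a, P t a & eball y ((t0 + 1 + t0) * D) a.
  move=> tt0; have [a [Aa ya]] : exists a, P t a.
    apply: contrapT => nP; apply: H; exists t.
      by case/andP: tt0 => -> /ltW ->.
    move=> a Aa; rewrite ltNge; apply/negP => aP; apply: nP; by exists a.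
  exists a => //; rewrite /eball /= enormB.
  have := enorm_triangle (y + t *: (y - p)) y a.
  rewrite opprD addNKr enormN enormZ ger0_norm; last by case/andP: tt0 => /ltW.
  rewrite -/D; case/andP: tt0 => tgt0 tlt0.
  have : t * D <= t0 * D by rewrite ler_pM2r// ltW.
  have : q * (t * D) <= t * D by rewrite ger_pMl ?ltW// mulr_gt0.
  by lra.
have [a clP] := bounded_family_cluster t00 PB.
(* the accumulation point is nearest to y, hence is p *)
have Aa : A a.
  rewrite (closure_id A).1// => U /nbhs_eballP[e e0 eU].
  have [t [a' [_ aa' [Aa' _]]]] := clP e e0.
  by exists a'; split => //; exact: eU.
have ya : enorm (y - a) <= D.
  apply/ler_addgt0Pr => e e0.
  have e'0 : 0 < e / (1 + D + D) by rewrite divr_gt0// !addr_gt0.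
  have [t [a' [/andP[tgt0 te] aa' [Aa' Hy]]]] := clP _ e'0.
  have := enorm_triangle (y + t *: (y - p)) y a.
  rewrite opprD addNKr enormN enormZ ger0_norm ?(ltW tgt0)// -/D.
  have := enorm_triangle a' (y + t *: (y - p)) a.
  move: aa'; rewrite /eball /= => aa'.
  have : q * (t * D) <= t * D by rewrite ger_pMl ?ltW// mulr_gt0.
  have : t * D <= e / (1 + D + D) * D by rewrite ler_pM2r.
  have : e / (1 + D + D) * (1 + D + D) = e.
    by rewrite divfK// gt_eqF// !addr_gt0.
  lra.
have {Aa ya} ap : a = p.
  by apply: pU; split => // b Ab; apply: le_trans ya (yp _ Ab).
have e0 : 0 < (1 - q) * D / 2 by rewrite divr_gt0// mulr_gt0// subr_gt0.
have [t [a' [/andP[tgt0 _] aa' [Aa' Hy]]]] := clP _ e0.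
move: aa'; rewrite ap /eball /= => pa'.
have yDa' : D ^+ 2 <= dot (y - a') (y - a').
  by rewrite -sqr_enorm ler_sqr ?nnegrE ?enorm_ge0// yp.
have DD : dot (y - p) (y - p) = D ^+ 2 by rewrite sqr_enorm.
have np : dot (y - p) (a' - p) <= D * ((1 - q) * D / 2).
  by apply: (le_trans (dot_le_enorm _ _)); rewrite ler_pM2l.
move: Hy; rewrite enorm_le_sqr;
  last by rewrite addr_ge0 ?mulr_ge0 ?(ltW D0) ?(ltW tgt0).
have -> : y + t *: (y - p) - a' = (y - a') + t *: (y - p) by rewrite addrAC.
have E : dot (y - a') (y - p) = D ^+ 2 - dot (y - p) (a' - p).
  rewrite -DD !dotE (dotC a' y) (dotC a' p) (dotC p y); ring.
rewrite !(dotDl (y - a')) !(dotDr _ (y - a')) !dotZl !dotZr.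
rewrite (dotC (y - p) (y - a')) DD E.
have tD : 0 < t * D ^+ 2 by rewrite mulr_gt0// exprn_gt0.
have q2 : q * q < 1 by nra.
have : t * dot (y - p) (a' - p) <= t * (D * ((1 - q) * D / 2)) by rewrite ler_pM2l.
have : 0 < t * (t * D ^+ 2) * (1 - q * q) by rewrite !mulr_gt0// subr_gt0.
have : 0 < t * D ^+ 2 * (1 - q) by rewrite !mulr_gt0// subr_gt0.
nra.
Qed.

(** A point x of the closing outside A would let d(y) - q |y - x| have a maximiser y
    on the ball of radius r around x; [distance_slope] pushes y to the sphere, where
    d(y) > r. *)
Lemma unique_nearest_bullet A r : closed A -> 0 < r ->
  (forall y, offset A r y -> exists! x, is_nearest A y x) -> bullet A r = A.
Proof.
move=> cA r0 U; apply/seteqP; split; last exact: sub_bullet.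
move=> x /bulletP -/(_ r0) xrA; apply: contrapT => nAx.
have eball_center y : eball y r y.
  by rewrite /eball /= subrr enorm0 ltW.
have A0 : A !=set0.
  by have [|a Aa _] := (offsetP A x (ltW r0)).1 _; [exact: xrA|exists a].
have /choice[p pP] : forall y, exists a, is_nearest A y a.
  by move=> y; exact: nearest_exists.
pose f y := enorm (y - p y).
have f_le y a : A a -> f y <= enorm (y - a) by case: (pP y) => _; apply.
have f_offset y : offset A r y -> f y <= r.
  by move=> /offsetP -/(_ (ltW r0))[a Aa]; apply: le_trans; exact: f_le.
have f_lip y z : f z <= f y + enorm (z - y).
  apply: (le_trans (f_le _ _ (pP y).1)).
  by have := enorm_triangle y z (p y); rewrite /f; lra.
have fx0 : 0 < f x.
  rewrite enorm_gt0 subr_eq0; apply/eqP => xpx; apply: nAx.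
  by rewrite xpx; exact: (pP x).1.
have fxr : f x <= r by apply/f_offset/xrA.
(* this slope is below 1, yet climbing at it over a distance r from height f x
   ends above r *)
pose q := 1 - f x / (2 * r).
have qr : q * r = r - f x / 2 by rewrite /q; field; rewrite gt_eqF.
have q01 : 0 <= q < 1.
  rewrite -(pmulr_lge0 _ r0) qr -(ltr_pM2r r0) qr; apply/andP; split; lra.
have fc : continuous f.
  move=> y; apply/(@cvgrPdist_le _ _ _ _ (nbhs_filter y)) => e e0.
  apply/nbhs_eballP; exists e => // z.
  rewrite /eball /= => zy; rewrite ler_distl.
  by have := f_lip y z; have := f_lip z y; rewrite (enormB y z); lra.
have Fc : {within eball x r, continuous (fun y => f y - q * enorm (y - x))}.
  apply: continuous_subspaceT => y; apply: continuousB; first exact: fc.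
  by apply: continuousM; [exact: cst_continuous|exact: edist_continuous].
have [y] := compact_EVT_max (ex_intro _ x (eball_center x))
  (@eball_compact _ _ x r) Fc.
rewrite inE => yr ymax; have yx : enorm (y - x) <= r := yr.
have := ymax x; rewrite inE => /(_ (eball_center x)).
rewrite subrr enorm0 mulr0 subr0 => Fxy.
have fyr : f y <= r by apply/f_offset/xrA.
have q0 : 0 <= q by case/andP: q01.
have qyx : 0 <= q * enorm (y - x) by rewrite mulr_ge0 ?enorm_ge0.
have {yx} yx : enorm (y - x) < r.
  rewrite lt_neqAle yx andbT; apply/eqP => yxr; move: Fxy; rewrite yxr qr; lra.
have fy0 : 0 < f y by lra.
have pU a : is_nearest A y a -> a = p y.
  by have [b [_ bU]] := U y (xrA y yr) => /bU <-; apply: bU.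
have t00 : 0 < (r - enorm (y - x)) / f y by rewrite divr_gt0// subr_gt0.
have [t /andP[t0 tle] /(_ _ (pP (y + t *: (y - p y))).1)] :=
  distance_slope cA (pP y) pU fy0 q01 t00.
set y' := y + t *: (y - p y); rewrite -/(f y) -/(f y') => y'up.
have y'x : enorm (y' - x) <= enorm (y - x) + t * f y.
  have := enorm_triangle y y' x; rewrite (_ : y' - y = t *: (y - p y)).
    rewrite enormZ ger0_norm ?(ltW t0)// -/(f y); lra.
  by rewrite /y' addrAC subrr add0r.
have y'r : eball x r y'.
  rewrite /eball /=; move: tle; rewrite ler_pdivlMr//; lra.
have := ymax y'; rewrite inE => /(_ y'r).
have : q * enorm (y' - x) <= q * (enorm (y - x) + t * f y) by rewrite ler_wpM2l.
lra.
Qed.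

End Offsets.

(** * Balls touching a hypersurface *)

Section Hypersurface.
Context {R : realType} {d : nat}.
Implicit Types (A M : set 'rV[R]_d) (x y z g u n w : 'rV[R]_d) (h : 'rV[R]_d -> R).

(** Only what the contact argument needs of a C^1 equation of M near x: the
    derivatives along the lines through x, g being the gradient, and the inclusion
    of the zero set in M. *)
Definition defining_function M rho x h g : Prop :=
  [/\ g != 0, h x = 0,
      forall y, eball x rho y -> {for y, continuous h} /\ (h y = 0 -> M y) &
      forall u, is_derive x u h (dot g u)].

Lemma defining_functionN M rho x h g :
  defining_function M rho x h g -> defining_function M rho x (- h) (- g).
Proof.
move=> [g0 hx hM dh]; split.
- by rewrite oppr_eq0.
- by rewrite /GRing.opp/= hx oppr0.
- move=> y /hM[hc My]; split; first exact: continuousN.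
  by move=> /eqP; rewrite oppr_eq0 => /eqP.
- by move=> u; rewrite dotNl; exact: is_deriveN.
Qed.

(** The defining function is the last coordinate of the straightening map; its
    gradient at x does not vanish, since by the chain rule its product with the
    derivative of the inverse map along the last basis vector is 1. *)
Lemma C1_hypersurface_defining_function M x : (0 < d)%N ->
  C1_submanifold d.-1 M -> M x -> 
  exists rho h g, 0 < rho /\ defining_function M rho x h g.
Proof.
move=> d0 submfd Mx; have [U [V [phi [psi [Ux]]]]] := submfd x Mx.
move=> [[oU oV cphi cpsi] [UV VU phiK psiK] imM].
have jd : (d.-1 < d)%N by rewrite ltn_predL.
pose j := Ordinal jd.
have imE y : U y -> (M y <-> phi y ord0 j = 0).
  move=> Uy; split=> [My|py].
    have : (phi @` (M `&` U)) (phi y) by exists y.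
    by rewrite imM => -[_]; exact.
  have : (V `&` [set y | forall j : 'I_d, (d.-1 <= j)%N -> y ord0 j = 0]) (phi y).
    split=> [|k dk]; first exact: UV.
    rewrite (_ : k = j)//; apply/val_inj => /=; apply/eqP.
    by rewrite eqn_leq dk andbT -ltnS prednK.
  by rewrite -imM => -[m [Mm Um] /(congr1 psi)]; rewrite !phiK// => <-.
have dcoord (z : 'rV[R]_d) : differentiable (fun y : 'rV[R]_d => y ord0 j) z.
  exact: differentiable_coord.
pose h y := phi y ord0 j.
have dh y : U y -> differentiable h y.
  move=> Uy; rewrite (_ : h = (fun y : 'rV[R]_d => y ord0 j) \o phi)//.
  by apply: differentiable_comp => //; case: (cphi y Uy).
pose g := (col j (jacobian phi x))^T.
have Dphi u : ('d phi x u) ord0 j = dot g u.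
  rewrite -deriveE; last by case: (cphi x Ux).
  rewrite deriveEjacobian; last by case: (cphi x Ux).
  by rewrite mxE; apply: eq_bigr => i _; rewrite !mxE mulrC.
have [rho rho0 rhoU] : exists2 rho, 0 < rho & eball x rho `<=` U.
  by apply/nbhs_eballP; exact: open_nbhs_nbhs.
exists rho, h, g; split => //; split.
- have dphi : differentiable phi (psi (phi x)) by rewrite phiK//; case: (cphi x Ux).
  have dpsi : differentiable psi (phi x) by case: (cpsi _ (UV x Ux)).
  pose v : 'rV[R]_d := delta_mx ord0 j.
  have nid : \forall y \near phi x, (phi \o psi) y = id y.
    by apply: filterS (open_nbhs_nbhs (conj oV (UV x Ux))) => y /psiK.
  have DE := deriveE v (differentiable_comp dpsi dphi).
  rewrite (near_eq_derive v nid) derive_id in DE.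
  have dc := congr1 (@^~ v) (diff_comp dpsi dphi).
  have Dv : 'd phi (psi (phi x)) ('d psi (phi x) v) = v :=
    etrans (esym dc) (esym DE).
  rewrite (phiK x Ux) in Dv.
  have vj : v ord0 j = 1 by rewrite mxE !eqxx.
  apply/eqP => g0; have := etrans (esym (Dphi ('d psi (phi x) v)))
    (congr1 (fun w : 'rV[R]_d => w ord0 j) Dv).
  rewrite vj g0 -(scale0r 0) dotZl mul0r.
  by move=> /esym/eqP; rewrite oner_eq0.
- by case: (imE x Ux) => /(_ Mx) hx0 _.
- move=> y /rhoU Uy; split; first exact/differentiable_continuous/dh.
  by case: (imE y Uy).
- move=> u.
  have dphi : differentiable phi x by case: (cphi x Ux).
  apply: DeriveDef; first exact/diff_derivable/dh.
  have := congr1 (fun w : 'rV[R]_d => w ord0 j)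
    (derive_mx (diff_derivable (v := u) dphi)).
  by rewrite mxE (deriveE u dphi) Dphi.
Qed.

(** By convexity the segment from a to b stays in both balls, so a change of sign of
    h would produce a point of M in a ball that misses M. *)
Lemma defining_function_same_sign M rho x h g c r a b :
  defining_function M rho x h g ->
  (forall y, M y -> ~ eball c r y) ->
  eball x rho a -> eball x rho b -> eball c r a -> eball c r b ->
  0 < h a -> 0 < h b.
Proof.
move=> [_ _ hM _] cM xa xb ca cb ha; rewrite ltNge; apply/negP => hb.
pose k t := h (a + t *: (b - a)).
have kc : {within `[0, 1], continuous k}.
  apply: continuous_in_subspaceT => t; rewrite inE /= in_itv /= => t01.
  rewrite /k; apply: (@continuous_comp R _ _ (fun t : R => a + t *: (b - a)) h).
    apply: continuousD; first exact: cst_continuous.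
    by apply: cvgZr_tmp; exact: cvg_id.
  by apply: (hM _ _).1; exact: eball_convex.
have k01 : Num.min (k 0) (k 1) <= 0 <= Num.max (k 0) (k 1).
  rewrite /k scale0r addr0 scale1r addrC subrK ge_min hb orbT le_max.
  by rewrite (ltW ha).
have [t t01 kt0] := IVT ler01 kc k01.
apply: (cM (a + t *: (b - a))); last exact: eball_convex.
by apply: (hM _ _).2 => //; exact: eball_convex.
Qed.

Lemma defining_function_derive_ge0 M rho x h g u :
  defining_function M rho x h g ->
  (forall e, 0 < e -> exists2 t, 0 < t <= e & 0 <= h (x + t *: u)) ->
  0 <= dot g u.
Proof.
move=> [_ hx _ dh] H; rewrite leNgt; apply/negP => gu0.
have [dhu hu] := dh u.
have /cvgr_lt/(_ 0 gu0) :
    (fun t => t^-1 *: ((h \o shift x) (t *: u) - h x)) @ 0^' --> dot g u.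
  by rewrite -hu.
move=> [e /= e0 He]; have [|t /andP[t0 te]] := H (e / 2); first by rewrite divr_gt0.
apply/negP; rewrite -ltNge.
have := He t; rewrite /= sub0r normrN gtr0_norm// hx subr0 addrC.
by rewrite /GRing.scale/= pmulr_rlt0 ?invr_gt0// ; apply; [lra|rewrite gt_eqF].
Qed.

(** A nonzero linear form that is nonnegative on an open half-space has the same kernel as
    the linear form defining the half-space: test it on - p + del w, with p the
    component of g orthogonal to w and del small. *)
Lemma half_space_normal g w : w != 0 -> g != 0 ->
  (forall u, 0 < dot u w -> 0 <= dot g u) -> exists2 c, 0 < c & g = c *: w.
Proof.
move=> w0 g0 H.
have ww : 0 < dot w w by rewrite lt_neqAle eq_sym dotxx_eq0 w0 dotxx_ge0.
pose c := dot g w / dot w w; pose p := g - c *: w.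
have pw : dot p w = 0 by rewrite !dotE divfK ?subrr// gt_eqF.
have gp : dot g p = dot p p.
  have gE : g = p + c *: w by rewrite subrK.
  by rewrite {1}gE dotDl dotZl (dotC w) pw mulr0 addr0.
have c0 : 0 <= c by apply: divr_ge0; [exact: H|exact: ltW].
have p0 : p = 0.
  apply/eqP; rewrite -dotxx_eq0 eq_le dotxx_ge0 andbT.
  apply/ler_addgt0Pr => e e0; rewrite add0r.
  pose del := e / (1 + dot g w).
  have gw1 : 0 < 1 + dot g w by rewrite ltr_pwDl// H.
  have del0 : 0 < del by rewrite divr_gt0.
  have := H (- p + del *: w).
  rewrite dotDl dotNl dotZl pw oppr0 add0r mulr_gt0// => /(_ isT).
  rewrite dotDr dotNr dotZr gp.
  have : del * (1 + dot g w) = e by rewrite divfK// gt_eqF.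
  nra.
have gE : g = c *: w by apply/eqP; rewrite -subr_eq0 -/p p0.
exists c => //; rewrite lt_neqAle c0 andbT eq_sym; apply: contraNneq g0 => c00.
by rewrite gE c00 scale0r.
Qed.

(** Two balls touching a hypersurface M at x without crossing it, the first
    centred at x + n and the second a limit of balls that miss M and contain
    points x + t n of the first, lie on the same side of M: replacing h by - h if
    needed, h is positive near x on both, so that both n and w are positive
    multiples of its gradient. *)
Lemma touching_balls_aligned M rho x h g n w :
  0 < rho -> defining_function M rho x h g ->
  n != 0 -> w != 0 ->
  (forall y, M y -> enorm n <= enorm (y - (x + n))) ->
  (forall e, 0 < e -> exists t z, [/\ 0 < t <= e, eball (x + w) e z,
     eball z (enorm w) (x + t *: n) & forall y, M y -> ~ eball z (enorm w) y]) ->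
  exists2 c, 0 < c & w = c *: n.
Proof.
move=> rho0 hgM n0 w0 nM wM.
have en0 : 0 < enorm n by rewrite enorm_gt0.
pose t1 := Num.min (1 / 2) (rho / enorm n).
have t1gt0 : 0 < t1 by rewrite lt_min !divr_gt0.
have t1lt1 : t1 < 1 by rewrite gt_min; apply/orP; left; lra.
have t1rho : t1 * enorm n <= rho by rewrite -ler_pdivlMr// ge_min lexx orbT.
have ray_rho t : 0 < t <= t1 -> eball x rho (x + t *: n).
  move=> /andP[t0 tt1]; rewrite /eball /= addrAC subrr add0r enormZ gtr0_norm//.
  by apply: le_trans t1rho; rewrite ler_pM2r.
have ray_in t : 0 < t <= t1 -> enorm (x + t *: n - (x + n)) < enorm n.
  move=> /andP[t0 tt1].
  have -> : x + t *: n - (x + n) = - ((1 - t) *: n).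
    by apply/rowP => i; rewrite !mxE; ring.
  rewrite enormN enormZ ger0_norm; last lra.
  by rewrite gtr_pMl//; lra.
(* orient h so that the side of M that contains both balls is the positive one *)
wlog hpos : h g hgM / 0 < h (x + t1 *: n).
  move=> W; case: (ltrgtP (h (x + t1 *: n)) 0) => [hneg|hpos|h0].
  - apply: (W (- h) (- g)); first exact: defining_functionN.
    by rewrite oppr_gt0.
  - exact: (W h g).
  - have t11 : 0 < t1 <= t1 by rewrite t1gt0 lexx.
    have [_ _ hM _] := hgM; have /nM := (hM _ (ray_rho _ t11)).2 h0.
    by rewrite leNgt ray_in.
have t11 : 0 < t1 <= t1 by rewrite t1gt0 lexx.
have n_side y : eball x rho y -> enorm (y - (x + n)) < enorm n -> 0 < h y.
  move=> xy yn.
  (* a closed ball inside the open one that contains both points *)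
  pose r := Num.max (enorm (y - (x + n))) (enorm (x + t1 *: n - (x + n))).
  apply: (defining_function_same_sign (c := x + n) (r := r) hgM _
    (ray_rho _ t11)) hpos => //.
  - move=> m /nM; rewrite /eball /= => + mr; apply/negP.
    by rewrite -ltNge (le_lt_trans mr)// gt_max yn ray_in.
  - by rewrite /eball /= le_max lexx orbT.
  - by rewrite /eball /= le_max lexx.
have w_side y : eball x rho y -> enorm (y - (x + w)) < enorm w -> 0 < h y.
  move=> xy yw.
  have [|t [z [/andP[t0 te] zw ztn zM]]] :=
    wM (Num.min t1 (enorm w - enorm (y - (x + w)))).
    by rewrite lt_min t1gt0 subr_gt0.
  have tt1 : 0 < t <= t1 by rewrite t0; move: te; rewrite le_min => /andP[].
  apply: (defining_function_same_sign hgM zM (ray_rho _ tt1)) => //; last first.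
    by apply: n_side; [exact: ray_rho|exact: ray_in].
  rewrite /eball /=; have := enorm_triangle (x + w) y z.
  move: zw; rewrite /eball /= le_min => /andP[_]; rewrite (enormB z); lra.
have normal v : v != 0 ->
    (forall y, eball x rho y -> enorm (y - (x + v)) < enorm v -> 0 < h y) ->
    exists2 c, 0 < c & g = c *: v.
  move=> v0 side; apply: half_space_normal => //; first by case: hgM.
  move=> u uv; apply: (defining_function_derive_ge0 hgM) => e e0.
  have uu : 0 <= dot u u := dotxx_ge0 u.
  have eu0 : 0 < enorm u + 1 by rewrite ltr_wpDl ?enorm_ge0.
  have uu1 : 0 < dot u u + 1 by rewrite ltr_wpDl.
  (* the last bound makes t^2 |u|^2 < 2 t <u, v>: x + t u is in the ball *)
  pose t := Num.min e (Num.min (rho / (enorm u + 1)) (dot u v / (dot u u + 1))).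
  have : t <= t by [].
  rewrite {2}/t !le_min !ler_pdivlMr// => /and3P[te tu tuv].
  have t0 : 0 < t by rewrite !lt_min e0 !divr_gt0.
  exists t; first by rewrite t0.
  apply/ltW/side.
    by rewrite /eball /= addrAC subrr add0r enormZ gtr0_norm//; lra.
  rewrite opprD addrACA subrr add0r enorm_lt_sqr ?enorm_ge0//.
  rewrite sqr_enorm !dotE (dotC v u).
  have : t * (t * (dot u u + 1)) <= t * dot u v by rewrite ler_pM2l.
  have : 0 < t * dot u v by rewrite mulr_gt0.
  nra.
have [a a0 gn] := normal n n0 n_side.
have [b b0 gw] := normal w w0 w_side.
exists (b^-1 * a); first by rewrite mulr_gt0 ?invr_gt0.
by rewrite -scalerA -gn gw scalerA mulVf ?scale1r// gt_eqF.
Qed.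

End Hypersurface.

(** * Reach and rconv *)

Section ReachRconv.
Context {R : realType} {d : nat}.
Implicit Types (A : set 'rV[R]_d) (x y z : 'rV[R]_d) (r : R).

(** If x were interior, points near x in the direction of y would be in A and closer
    to y than x is. *)
Lemma nearest_boundary A y x : is_nearest A y x -> y <> x -> boundary A x.
Proof.
move=> [Ax yx] yNx; split; first exact: subset_closure.
rewrite /interior => /nbhs_eballP[e e0 eA].
have n0 : 0 < enorm (y - x) by rewrite enorm_gt0 subr_eq0; apply/eqP.
pose t := Num.min (1 / 2) (e / enorm (y - x)).
have t0 : 0 < t by rewrite lt_min !divr_gt0.
have t1 : t <= 1 / 2 by rewrite ge_min lexx.
have te : t * enorm (y - x) <= e by rewrite -ler_pdivlMr// ge_min lexx orbT.
have /eA/yx : eball x e (x + t *: (y - x)).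
  by rewrite /eball /= addrAC subrr add0r enormZ gtr0_norm.
have -> : y - (x + t *: (y - x)) = (1 - t) *: (y - x).
  by apply/rowP => i; rewrite !mxE; ring.
rewrite enormZ gtr0_norm; last lra.
by nra.
Qed.

(** The centres z of the balls of radius r that miss A and contain the points
    y_t = x + t (y - x) accumulate, as t tends to 0, at the centre of a ball of
    radius r touching A at x. *)
Lemma bullet_touching_ball A r y x : 0 < r -> bullet A r = A ->
  is_nearest A y x -> y <> x -> exists z,
  [/\ enorm (z - x) = r, forall a, A a -> r <= enorm (z - a) &
    forall e, 0 < e -> exists t z', [/\ 0 < t <= e, eball z e z',
      eball z' r (x + t *: (y - x)) & forall a, A a -> ~ eball z' r a]].
Proof.
move=> r0 Ar [Ax yx] yNx; set n := y - x.
have n0 : 0 < enorm n by rewrite enorm_gt0 subr_eq0; apply/eqP.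
have PB t : 0 < t < 1 -> exists2 z,
    (eball z r (x + t *: n) /\ forall a, A a -> r < enorm (z - a)) &
    eball x (r + enorm n) z.
  move=> /andP[t0 t1].
  have [|z zr zA] := @bullet_notin _ _ A r (x + t *: n) r0 Ar.
    move=> /yx; have -> : y - (x + t *: n) = (1 - t) *: n.
      by apply/rowP => i; rewrite !mxE; ring.
    rewrite enormZ gtr0_norm; last lra.
    by rewrite -/n; nra.
  exists z; first by split => //; rewrite /eball /= enormB.
  have := enorm_triangle (x + t *: n) z x.
  rewrite /eball /= [x + _ - x]addrAC subrr add0r enormZ gtr0_norm//.
  move: zr; rewrite /eball /=; nra.
have [z zP] := bounded_family_cluster ltr01 PB.
have zA a : A a -> r <= enorm (z - a).
  move=> Aa; apply/ler_addgt0Pr => e e0.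
  have [t [z' [_ zz' [_ /(_ a Aa)]]]] := zP e e0.
  move: zz'; rewrite /eball /=; have := enorm_triangle z z' a; lra.
exists z; split => //.
  apply/eqP; rewrite eq_le zA// andbT; apply/ler_addgt0Pr => e e0.
  have n1 : 0 < 1 + enorm n by rewrite addr_gt0.
  have [|t [z' [/andP[t0 te] zz' [z't _]]]] := zP (e / (1 + enorm n)).
    by rewrite divr_gt0.
  have := enorm_triangle (x + t *: n) z x; have := enorm_triangle z' z (x + t *: n).
  rewrite [x + _ - x]addrAC subrr add0r enormZ gtr0_norm//.
  move: zz' z't (enormB z' z) (enormB z' (x + t *: n)); rewrite /eball /=.
  have : t * enorm n <= e / (1 + enorm n) * enorm n by rewrite ler_pM2r.
  have : e / (1 + enorm n) * (1 + enorm n) = e by rewrite divfK// gt_eqF.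
  lra.
move=> e e0; have [t [z' [te zz' [z't z'A]]]] := zP e e0.
exists t, z'; split => // a /z'A; rewrite /eball /= enormB => ra.
by apply/negP; rewrite -ltNge.
Qed.

(** Balls touching A at one nearest point x1 of y, around y and of radius r, are
    nested by [touching_balls_aligned], so that the larger leaves no room for a
    second nearest point. *)
Lemma bullet_unique_nearest A r y : closed A -> C1_submanifold d.-1 (boundary A) ->
  0 < r -> bullet A r = A -> (exists2 a, A a & enorm (y - a) < r) ->
  exists! x, is_nearest A y x.
Proof.
move=> cA smA r0 Ar [a Aa ya].
have [x1 nx1] : exists x, is_nearest A y x by apply: nearest_exists => //; exists a.
exists x1; split => // x2 nx2; apply: contrapT => x12.
have [[Ax1 yx1] [Ax2 yx2]] := (nx1, nx2).
have x1r : enorm (y - x1) < r by exact: le_lt_trans (yx1 a Aa) ya.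
have eqn : enorm (y - x2) = enorm (y - x1) by apply/eqP; rewrite eq_le yx1// yx2.
have yNx1 : y <> x1.
  move=> yE; apply: x12; rewrite -yE; apply/eqP; rewrite -subr_eq0 -enorm_eq0.
  by rewrite eqn yE subrr enorm_eq0.
have d0 : (0 < d)%N.
  rewrite lt0n; apply/eqP => dE; apply: x12; apply/rowP => -[i id0].
  by exfalso; move: id0; rewrite dE.
have [z [zx1 zA zP]] := bullet_touching_ball r0 Ar nx1 yNx1.
have [rho [h [g [rho0 hg]]]] :=
  C1_hypersurface_defining_function d0 smA (nearest_boundary nx1 yNx1).
have bA m : boundary A m -> A m by move=> [clm _]; rewrite (closure_id A).1.
have [||||c c0 wn] := touching_balls_aligned (n := y - x1) (w := z - x1) rho0 hg.
- by rewrite subr_eq0; apply/eqP.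
- by rewrite -enorm_gt0 zx1.
- by move=> m /bA Am; rewrite [x1 + _]addrC subrK [leRHS]enormB; exact: yx1.
- move=> e e0; have [t [z' [te zz' z't z'A]]] := zP e e0.
  exists t, z'; split => //; first by rewrite [x1 + _]addrC subrK.
  + by rewrite zx1.
  + by move=> m /bA Am; rewrite zx1; exact: z'A.
(* z is farther along the ray from x1 through y, so the ball centred at z
   contains x2, which lies on the sphere centred at y, in its interior *)
have n0 : 0 < enorm (y - x1) by rewrite enorm_gt0 subr_eq0; apply/eqP.
have c1 : 1 < c.
  by move: x1r; rewrite -zx1 wn enormZ gtr0_norm// ltr_pMl.
have q0 : 0 < dot (x2 - x1) (x2 - x1).
  by rewrite lt_neqAle dotxx_ge0 andbT eq_sym dotxx_eq0 subr_eq0; apply/eqP => /esym.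
have E1 : dot (y - x2) (y - x2) = dot (y - x1) (y - x1) by rewrite -!sqr_enorm eqn.
have := zA x2 Ax2; rewrite -zx1 enorm_le_sqr ?enorm_ge0// sqr_enorm.
have zE : z - x2 = c *: (y - x1) - (x2 - x1) by rewrite -wn opprB subrKA.
have yE : y - x2 = (y - x1) - (x2 - x1) by rewrite opprB subrKA.
rewrite zE wn; move: E1 q0; rewrite yE.
move: (y - x1) (x2 - x1) => n q; rewrite !dotE (dotC q n) => E1 q0.
nra.
Qed.

Lemma offset0 A : offset A 0 = A.
Proof.
apply/seteqP; split => y; rewrite offsetP//; last first.
  by move=> Ay; exists y => //; rewrite subrr enorm0.
move=> [a Aa]; rewrite le_eqVlt ltNge enorm_ge0 orbF enorm_eq0 subr_eq0.
by move=> /eqP ->.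
Qed.

Lemma rconv_ge0 A : (0 <= rconv A)%E.
Proof.
by apply: ereal_sup_ubound; exists 0 => //; rewrite /= /bullet oppr0 !offset0.
Qed.

Lemma reach_ge r A : 0 < r ->
  (forall y, offset A r y -> exists! x, is_nearest A y x) -> (r%:E <= reach A)%E.
Proof.
by move=> r0 U; rewrite le_max ereal_sup_ubound ?orbT//; exists r.
Qed.

End ReachRconv.

Theorem theorem1 (R : realType) (d : nat) (A : set 'rV[R]_d) (hA : closed A) :
  (reach A <= rconv A)%E /\
  (C1_submanifold d.-1 (boundary A) -> reach A = rconv A).
Proof.
have reach_rconv : (reach A <= rconv A)%E.
  rewrite ge_max rconv_ge0/=; apply: ge_ereal_sup => _ [r [r0 U] <-].
  by apply: ereal_sup_ubound; exists r => //; exact: unique_nearest_bullet.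
split => // smA; apply/eqP; rewrite eq_le reach_rconv/=.
apply: ge_ereal_sup => _ [r Ar <-].
have reach0 : (0 <= reach A)%E by rewrite le_max lexx.
have [r0|r0] := leP r 0; first by apply: le_trans reach0; rewrite lee_fin.
rewrite leNgt; apply/negP.
case E : (reach A) reach0 => [s| |] // + sr; rewrite lee_fin => s0.
rewrite lte_fin in sr.
have : (((s + r) / 2)%:E <= reach A)%E.
  apply: reach_ge => [|y]; first lra.
  move=> /offsetP[|a Aa ya]; first lra.
  by apply: (@bullet_unique_nearest _ _ _ r) => //; exists a => //; lra.
by rewrite E lee_fin; lra.
Qed.
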